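(* Given a germ $X\in\mathcal{X}_2\setminus\{0\}$, one of the following three possibilities holds: (a) $r(X)=d(X)=1$; in this case, $C(X)=\mathbb{C}\cdot X$. (b) $d(X)\geq2$ and $r(X)=1$; in this case, $X$ has a non-constant meromorphic first integral. (c) $r(X)=2$; in this case, $X$ is Liouvillian integrable.
   Context: $\mathcal{X}_2$ is the set of germs at $0\in\mathbb{C}^2$ of holomorphic vector fields. $C(X)=\{Y\in\mathcal{X}_2\mid[X,Y]=0\}$; $d(X)=\dim_{\mathbb{C}}C(X)\in\mathbb{N}\cup\{\infty\}$; $r(X)$ is the maximal $r$ such that there exist $Y_1,\dots,Y_r\in C(X)$ with $Y_1\wedge\dots\wedge Y_r\not\equiv0$. A meromorphic first integral of $X$ is a germ $f$ of meromorphic function at $0\in\mathbb{C}^2$ with $X(f)=0$. $X$ is Liouvillian integrable if the foliation it induces can be defined by a germ of closed meromorphic 1-form, i.e. there is a germ at $0\in\mathbb{C}^2$ of closed meromorphic 1-form $\alpha\not\equiv0$ with $\alpha(X)=0$. *)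

(* Defs.v *)
From HB Require Import structures.
From mathcomp Require Import all_boot all_order all_algebra.
From mathcomp Require Export complex.
From mathcomp Require Import all_classical all_reals all_analysis.

Set Implicit Arguments.
Unset Strict Implicit.
Unset Printing Implicit Defensive.

Import Order.TTheory GRing.Theory Num.Theory.
Import numFieldNormedType.Exports.

Local Open Scope classical_set_scope.
Local Open Scope ring_scope.

(* A germ at 0 is handled through a representative defined on the whole plane,
   whose values matter only near 0: every notion below is invariant under
   modification of the representatives away from 0, and equality of germs is
   [germ_eq].  The analytic notions make sense over any numFieldType K (which
   is what lets the topology on K^2 be inferred); they are used for K = R[i],
   the complex numbers, when R is a realType.  Points of K^2 and vectors at
   these points are row vectors. *)

Definition germ_eq (K : numFieldType) (T : Type) (f g : 'rV[K]_2 -> T) : Prop :=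
  \forall z \near (0 : 'rV[K]_2), f z = g z.

Notation "f =0= g" := (germ_eq f g) (at level 70, no associativity).

(* [differentiable] is relative to the field of scalars: over K = R[i] this is
   complex (Frechet) differentiability at all points of a neighbourhood of 0. *)
Definition holo_germ (K : numFieldType) (V : normedModType K)
    (f : 'rV[K]_2 -> V) : Prop :=
  \forall z \near (0 : 'rV[K]_2), differentiable f z.

Definition lie_bracket (K : numFieldType) (X Y : 'rV[K]_2 -> 'rV[K]_2) :
    'rV[K]_2 -> 'rV[K]_2 :=
  fun z => 'D_(X z) Y z - 'D_(Y z) X z.

Definition centralizer (K : numFieldType) (X : 'rV[K]_2 -> 'rV[K]_2) :
    set ('rV[K]_2 -> 'rV[K]_2) :=
  [set Y | holo_germ Y /\ lie_bracket X Y =0= (fun=> 0)].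

Definition free_germs (K : numFieldType) (n : nat)
    (Y : 'I_n -> 'rV[K]_2 -> 'rV[K]_2) : Prop :=
  forall c : 'I_n -> K,
    (fun z => \sum_i c i *: Y i z) =0= (fun=> 0) -> forall i, c i = 0.

(* Coordinate of Y_0 /\ ... /\ Y_(n-1) on e_(s 0) /\ ... /\ e_(s (n-1)). *)
Definition wedge (K : numFieldType) (n : nat)
    (Y : 'I_n -> 'rV[K]_2 -> 'rV[K]_2) (s : 'I_n -> 'I_2) : 'rV[K]_2 -> K :=
  fun z => \det (\matrix_(i, j) Y i z 0 (s j)).

(* The dimension of a complex vector space, in N u {oo}, is the supremum of the
   sizes of its finite linearly independent families. *)
Definition centralizer_dim (R : realType) (X : 'rV[R[i]]_2 -> 'rV[R[i]]_2) :
    \bar R :=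
  ereal_sup [set n%:R%:E | n in
    [set n : nat | exists Y : 'I_n -> 'rV[R[i]]_2 -> 'rV[R[i]]_2,
       (forall i, centralizer X (Y i)) /\ free_germs Y]].

(* The supremum is a maximum, as only sizes n <= 2 can occur. *)
Definition centralizer_rank (R : realType) (X : 'rV[R[i]]_2 -> 'rV[R[i]]_2) :
    \bar R :=
  ereal_sup [set n%:R%:E | n in
    [set n : nat | exists Y : 'I_n -> 'rV[R[i]]_2 -> 'rV[R[i]]_2,
       (forall i, centralizer X (Y i)) /\
       ~ (forall s, wedge Y s =0= (fun=> 0))]].

(* The quotient mero_num / mero_den.  The zero set of the denominator is nowhere
   dense near 0 (identity theorem), so identities between meromorphic germs are
   expressed outside the zero sets of the denominators involved. *)
Record mero_germ (K : numFieldType) := MeroGerm {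
  mero_num : 'rV[K]_2 -> K;
  mero_den : 'rV[K]_2 -> K;
  mero_num_holo : holo_germ (mero_num : 'rV[K]_2 -> K^o);
  mero_den_holo : holo_germ (mero_den : 'rV[K]_2 -> K^o);
  mero_den_neq0 : ~ (mero_den =0= (fun=> 0)) }.

Definition mero_fun (K : numFieldType) (f : mero_germ K) : 'rV[K]_2 -> K^o :=
  fun z => mero_num f z / mero_den f z.

Definition mero_const (K : numFieldType) (f : mero_germ K) : Prop :=
  exists c : K, \forall z \near (0 : 'rV[K]_2),
    mero_den f z != 0 -> mero_fun f z = c.

Definition first_integral (K : numFieldType) (X : 'rV[K]_2 -> 'rV[K]_2)
    (f : mero_germ K) : Prop :=
  \forall z \near (0 : 'rV[K]_2),
    mero_den f z != 0 -> 'D_(X z) (mero_fun f) z = 0.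

(* The meromorphic 1-form (form_dx a) dx + (form_dy a) dy. *)
Record mero_form (K : numFieldType) := MeroForm {
  form_dx : mero_germ K;
  form_dy : mero_germ K }.

Definition form_regular (K : numFieldType) (a : mero_form K) (z : 'rV[K]_2) :
    bool :=
  (mero_den (form_dx a) z != 0) && (mero_den (form_dy a) z != 0).

Definition form_eq0 (K : numFieldType) (a : mero_form K) : Prop :=
  \forall z \near (0 : 'rV[K]_2), form_regular a z ->
    mero_fun (form_dx a) z = 0 /\ mero_fun (form_dy a) z = 0.

Definition form_closed (K : numFieldType) (a : mero_form K) : Prop :=
  \forall z \near (0 : 'rV[K]_2), form_regular a z ->
    'D_(delta_mx 0 0) (mero_fun (form_dy a)) z
    - 'D_(delta_mx 0 1) (mero_fun (form_dx a)) z = 0.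

Definition form_kills (K : numFieldType) (a : mero_form K)
    (X : 'rV[K]_2 -> 'rV[K]_2) : Prop :=
  \forall z \near (0 : 'rV[K]_2), form_regular a z ->
    mero_fun (form_dx a) z * X z 0 0 + mero_fun (form_dy a) z * X z 0 1 = 0.

Definition liouvillian_integrable (K : numFieldType)
    (X : 'rV[K]_2 -> 'rV[K]_2) : Prop :=
  exists a : mero_form K,
    [/\ form_closed a, ~ form_eq0 a & form_kills a X].

(* Main.v *)
From HB Require Import structures.
Require Import Defs.
From mathcomp Require Import all_boot all_order all_algebra ring lra.
From mathcomp Require Import all_classical all_reals all_analysis.

Set Implicit Arguments.
Unset Strict Implicit.
Unset Printing Implicit Defensive.

Import Order.TTheory GRing.Theory Num.Theory.
Import numFieldNormedType.Exports.
Import Normc.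

Local Open Scope ring_scope.

(* If Y commutes with X and X /\ Y = 0, the ratio of corresponding components of
   Y and X is a first integral of X, constant only when Y is a multiple of X.
   If delta = det(X, Y) is not 0, then X(delta) = div(X) delta, which says that
   (X_1 dx - X_0 dy) / delta is closed.  These are pointwise identities in the
   first derivatives; the only analytic input is that germs of holomorphic
   functions form an integral domain, i.e. unique continuation along complex
   lines.

   If F is complex differentiable on |z| < 10 and vanishes near 0, then
   F(z) / z^n extends by 0 at 0.  Cauchy's estimate on the square of centre 1 and
   half side 4, on whose boundary |z| >= 3, gives |F(1)| <= 2 M / 3^n for all n,
   so F(1) = 0.  Cauchy's estimate is obtained without integrals: the iterated
   trapezoidal sums over the boundary of a square are additive under subdivision
   into nine squares and vanish on affine functions, so that Goursat's argument
   applies to them. *)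

(** * Cauchy's estimate on squares *)

Ltac complex_eq :=
  apply/eqP; rewrite eq_complex /=; apply/andP; split; apply/eqP.

Section CauchyEstimate.
Variable R : realType.
Local Notation C := R[i].
Local Notation "x %:C" := (real_complex R x).
Local Notation Re := (@complex.Re R).
Local Notation Im := (@complex.Im R).
Local Notation Complex := (@complex.Complex R).
Implicit Types (F G : C -> C) (a b z p : C) (s t : R).

Lemma normcZ t z : 0 <= t -> normc (t%:C * z) = t * normc z.
Proof.
move=> t0; rewrite normcM; congr (_ * _).
by rewrite /normc /= expr0n addr0 sqrtr_sqr ger0_norm.
Qed.

Lemma normc_ge0 z : 0 <= normc z.
Proof. by case: z => x y; exact: sqrtr_ge0. Qed.

(** * Squares in the plane and induction on their subdivision *)

Definition in_square a s z :=
  [/\ Re a <= Re z, Re z <= Re a + s, Im a <= Im z & Im z <= Im a + s].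

(** The indices are natural numbers rather than elements of ['I_3] because the value 3 is needed as
    well, for the grid points on the far sides. *)
Definition subcorner a s (j k : nat) : C :=
  a + Complex (j%:R * (s / 3)) (k%:R * (s / 3)).

Lemma ReD a b : Re (a + b) = Re a + Re b. Proof. by case: a b => ? ? []. Qed.
Lemma ReN a : Re (- a) = - Re a. Proof. by case: a. Qed.
Lemma ImN a : Im (- a) = - Im a. Proof. by case: a. Qed.
Lemma ImD a b : Im (a + b) = Im a + Im b. Proof. by case: a b => ? ? []. Qed.

Lemma in_square_sub a s (j k : 'I_3) z : 0 <= s ->
  in_square (subcorner a s j k) (s / 3) z -> in_square a s z.
Proof.
move=> s0; rewrite /in_square /subcorner !ReD !ImD /=.
have h (i : 'I_3) : 0 <= (i%:R : R) <= 2 by rewrite ler0n ler_nat -ltnS ltn_ord.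
have h3 : 0 <= s / 3 by lra.
have hj : 0 <= (j : nat)%:R * (s / 3) <= 2 * (s / 3).
  by have /andP[j0 j2] := h j; rewrite mulr_ge0 // ler_wpM2r.
have hk : 0 <= (k : nat)%:R * (s / 3) <= 2 * (s / 3).
  by have /andP[k0 k2] := h k; rewrite mulr_ge0 // ler_wpM2r.
move: ((j : nat)%:R * (s / 3)) ((k : nat)%:R * (s / 3)) hj hk => u v hj hk.
by case=> *; split; lra.
Qed.

Lemma expr3_gt t : exists n, t < 3 ^+ n.
Proof.
exists (Num.bound `|t|).
have t1 : t < (Num.bound `|t|)%:R.
  by apply: le_lt_trans (ler_norm t) _; apply: archi_boundP.
apply: lt_le_trans t1 _; rewrite -natrX ler_nat.
by apply: ltnW; apply: ltn_expl.
Qed.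

(** Cousin's principle, used in place of compactness. If [P] failed, it would fail on one of the
    nine cells, then on a cell of that cell, and so on; these nested squares shrink to a point,
    where the local hypothesis gives a contradiction. *)
Lemma square_cousin (P : C -> R -> Prop) a s : 0 < s ->
  (forall a' s', 0 < s' ->
     (forall j k : 'I_3, P (subcorner a' s' j k) (s' / 3)) -> P a' s') ->
  (forall p, in_square a s p -> exists2 d : R, 0 < d &
     forall a' s', 0 < s' -> s' < d -> in_square a' s' p ->
       (forall z, in_square a' s' z -> in_square a s z) -> P a' s') ->
  P a s.
Proof.
move=> s_gt0 Psub Ploc; apply: contrapT => nP.
have s3 n : 0 < s / 3 ^+ n by rewrite divr_gt0 // exprn_gt0.
(* The failure of [P] is assumed inside the existential so that [choice] yields a total selector;
   where [P] holds, the value [(ord0, ord0)] is arbitrary. *)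
have /choice[nxt nxtP] (q : C * nat) : exists q' : 'I_3 * 'I_3,
    ~ P q.1 (s / 3 ^+ q.2) ->
    ~ P (subcorner q.1 (s / 3 ^+ q.2) q'.1 q'.2) (s / 3 ^+ q.2.+1).
  have [Pq|nPq] := pselect (P q.1 (s / 3 ^+ q.2)).
    by exists (ord0, ord0).
  apply: contrapT => noq; apply: nPq; apply: Psub => // j k.
  apply: contrapT => nPjk; apply: noq; exists (j, k) => _ /=.
  by rewrite exprSr invfM mulrA.
pose fix c n := if n is m.+1 then
  subcorner (c m) (s / 3 ^+ m) (nxt (c m, m)).1 (nxt (c m, m)).2 else a.
have nPc n : ~ P (c n) (s / 3 ^+ n).
  elim: n => [|n IH] /=; first by rewrite expr0 divr1.
  exact: (nxtP (c n, n)).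
have cS n z : in_square (c n.+1) (s / 3 ^+ n.+1) z ->
    in_square (c n) (s / 3 ^+ n) z.
  rewrite exprSr invfM mulrA => /in_square_sub; apply; exact/ltW.
have cle n m z : (n <= m)%N -> in_square (c m) (s / 3 ^+ m) z ->
    in_square (c n) (s / 3 ^+ n) z.
  move=> /subnKC <-; elim: (m - n)%N z => [|k IH] z; rewrite ?addn0 // addnS.
  by move=> /cS; exact: IH.
have cc n : in_square (c n) (s / 3 ^+ n) (c n).
  by have := s3 n; split; lra.
(* Holds whichever of [n] and [m] is larger, since the squares are nested. Hence the suprema of the
   coordinates of the corners lie in every square. *)
have cub n m : Re (c m) <= Re (c n) + s / 3 ^+ n /\
               Im (c m) <= Im (c n) + s / 3 ^+ n.
  have [nm|/ltnW mn] := leqP n m; first by have [] := cle _ _ _ nm (cc m).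
  by have [] := cle _ _ _ mn (cc n); have := s3 n; split; lra.
have sup_in (f : nat -> R) : (forall n m, f m <= f n + s / 3 ^+ n) ->
    forall n, f n <= sup (range f) <= f n + s / 3 ^+ n.
  move=> fub n; apply/andP; split.
    apply: ub_le_sup; last by exists n.
    by exists (f 0%N + s / 3 ^+ 0) => _ [m _ <-].
  apply: ge_sup; first by exists (f 0%N); exists 0%N.
  by move=> _ [m _ <-].
pose p := Complex (sup (range (fun n => Re (c n))))
  (sup (range (fun n => Im (c n)))).
have pc n : in_square (c n) (s / 3 ^+ n) p.
  have /andP[? ?] := sup_in (fun n => Re (c n)) (fun n m => (cub n m).1) n.
  have /andP[? ?] := sup_in (fun n => Im (c n)) (fun n m => (cub n m).2) n.
  by split.
have [|d d0 dP] := Ploc p; first by have := pc 0%N; rewrite expr0 divr1.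
have [n sn] := expr3_gt (s / d).
apply: (nPc n); apply: dP => //.
  by rewrite ltr_pdivrMr ?exprn_gt0 // mulrC -ltr_pdivrMr.
by move=> z /(cle 0%N n z (leq0n n)); rewrite expr0 divr1.
Qed.

(* Iterated trapezoidal rule: a discrete curve integral of [F] along the
   segment from [a] to [b], additive under trisection by construction. *)
Fixpoint trap (m : nat) F a b : C :=
  if m is m'.+1 then
    trap m' F a (a + (b - a) / 3) +
    trap m' F (a + (b - a) / 3) (a + (b - a) / 3 * 2) +
    trap m' F (a + (b - a) / 3 * 2) b
  else (b - a) * ((F a + F b) / 2).

Lemma trapD m F G a b :
  trap m (fun z => F z + G z) a b = trap m F a b + trap m G a b.
Proof.
elim: m a b => [|m IH] a b /=; last by rewrite !IH; ring.
by field.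
Qed.

(** The trapezoidal rule is exact here: the value is the increment of the primitive
    [u * z + v * z ^+ 2 / 2], so it cancels around a closed contour. *)
Lemma trap_affine m (u v : C) a b :
  trap m (fun z => u + v * z) a b = (b - a) * (u + v * ((a + b) / 2)).
Proof.
elim: m a b => [|m IH] a b /=; last by rewrite !IH; field.
by field.
Qed.

Lemma trapZ m (u : C) F a b : trap m (fun z => u * F z) a b = u * trap m F a b.
Proof.
elim: m a b => [|m IH] a b /=; last by rewrite !IH; ring.
by field.
Qed.

(** The sum is an average of values of [(b - a) * F] on the segment, so a sublinear bound on those
    values passes to it. The cases of interest for [phi] are the modulus and plus or minus the
    imaginary part. *)
Lemma trap_sublinear (phi : C -> R) m F a b (c : R) :
  (forall x y, phi (x + y) <= phi x + phi y) ->
  (forall t z, 0 <= t -> phi (t%:C * z) <= t * phi z) ->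
  (forall t, 0 <= t -> t <= 1 -> phi ((b - a) * F (a + t%:C * (b - a))) <= c) ->
  phi (trap m F a b) <= c.
Proof.
move=> phiD phiZ; elim: m a b c => [|m IH] a b c bound /=.
  have h2 : (2^-1 : R) >= 0 by lra.
  have -> : (b - a) * ((F a + F b) / 2) =
      (2^-1)%:C * ((b - a) * F a) + (2^-1)%:C * ((b - a) * F b).
    by rewrite rmorphV ?unitfE ?pnatr_eq0 // rmorph_nat; field.
  apply: le_trans (phiD _ _) _.
  have := phiZ _ ((b - a) * F a) h2; have := phiZ _ ((b - a) * F b) h2.
  have := bound 0 (lexx _) ler01; have := bound 1 ler01 (lexx _).
  rewrite rmorph0 rmorph1 mul0r addr0 mul1r (addrC a (b - a)) subrK.
  by set u := phi (_ * F a); set v := phi (_ * F b); lra.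
have t3 : (3^-1 : R)%:C = (3^-1 : C).
  by rewrite rmorphV ?unitfE ?pnatr_eq0 // rmorph_nat.
(* Parameter [t] on the third number [k] is parameter [(k + t) / 3] on the whole segment; the length
   contributes the factor 1/3. *)
have third a' b' (k : nat) : (k < 3)%N -> a' = a + (b - a) / 3 * k%:R ->
    b' - a' = (b - a) / 3 -> phi (trap m F a' b') <= c / 3.
  move=> k3 a'E b'E; apply: IH => t t0 t1; rewrite b'E.
  have -> : a' + t%:C * ((b - a) / 3) = a + ((k%:R + t) / 3)%:C * (b - a).
    by rewrite a'E rmorphM rmorphD rmorph_nat /= t3; field.
  set w := F _.
  have -> : (b - a) / 3 * w = (3^-1)%:C * ((b - a) * w) by rewrite t3; field.
  have h3 : (3^-1 : R) >= 0 by lra.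
  apply: le_trans (phiZ _ _ h3) _; rewrite mulrC ler_pM2r ?invr_gt0 //.
  have k2 : 0 <= (k%:R : R) <= 2 by rewrite ler0n ler_nat -ltnS.
  by apply: bound; lra.
have := third a (a + (b - a) / 3) 0%N isT; rewrite mulr0 addr0.
have -> : a + (b - a) / 3 - a = (b - a) / 3 by ring.
move=> /(_ erefl erefl).
have := third (a + (b - a) / 3) (a + (b - a) / 3 * 2) 1%N isT.
rewrite mulr1 => /(_ erefl).
have -> : a + (b - a) / 3 * 2 - (a + (b - a) / 3) = (b - a) / 3 by field.
move=> /(_ erefl).
have := third (a + (b - a) / 3 * 2) b 2%N isT erefl.
have -> : b - (a + (b - a) / 3 * 2) = (b - a) / 3 by field.
move=> /(_ erefl).
move=> h1 h2 h3.
apply: le_trans (phiD _ _) _; apply: le_trans (lerD (phiD _ _) (lexx _)) _.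
by lra.
Qed.

Lemma normc_trap m F a b (M : R) :
  (forall t, 0 <= t -> t <= 1 -> normc (F (a + t%:C * (b - a))) <= M) ->
  normc (trap m F a b) <= normc (b - a) * M.
Proof.
move=> bound; apply: trap_sublinear; first exact: le_normcD.
  by move=> t z t0; rewrite normcZ.
by move=> t t0 t1; rewrite normcM ler_wpM2l ?normc_ge0 // bound.
Qed.

(** * Discrete contour integrals over squares *)

Definition hside s : C := s%:C.
Definition vside s : C := Complex 0 s.

(** The contour runs counterclockwise; the top and left sides are traversed backwards, hence the two
    minus signs. *)
Definition square_sum m F a s : C :=
  trap m F a (a + hside s) + trap m F (a + hside s) (a + hside s + vside s)
  - trap m F (a + vside s) (a + hside s + vside s) - trap m F a (a + vside s).

(** Each inner edge of the grid is shared by two cells with opposite signs, and three outer edges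
    make up a side by the recursion of [trap]. This is why one subdivision consumes one level. *)
Lemma square_sumS m F a s : square_sum m.+1 F a s =
  \sum_(j < 3) \sum_(k < 3) square_sum m F (subcorner a s j k) (s / 3).
Proof.
pose H (j k : nat) := trap m F (subcorner a s j k) (subcorner a s j.+1 k).
pose V (j k : nat) := trap m F (subcorner a s j k) (subcorner a s j k.+1).
have subh (j k : nat) : subcorner a s j k + hside (s / 3) = subcorner a s j.+1 k.
  rewrite /subcorner /hside -addrA; congr (_ + _).
  by complex_eq; field.
have subv (j k : nat) : subcorner a s j k + vside (s / 3) = subcorner a s j k.+1.
  rewrite /subcorner /vside -addrA; congr (_ + _).
  by complex_eq; field.
have cellE (j k : nat) : square_sum m F (subcorner a s j k) (s / 3) =
    H j k + V j.+1 k - H j k.+1 - V j k.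
  by rewrite /square_sum !subh !subv.
transitivity (H 0%N 0%N + H 1%N 0%N + H 2%N 0%N
  + (V 3%N 0%N + V 3%N 1%N + V 3%N 2%N)
  - (H 0%N 3%N + H 1%N 3%N + H 2%N 3%N)
  - (V 0%N 0%N + V 0%N 1%N + V 0%N 2%N)); last first.
  by rewrite !big_ord_recr !big_ord0 /= !cellE; ring.
have s3 : 3 * (s / 3) = s by lra.
have pt (j k : nat) : subcorner a s j k =
    a + hside s / 3 * j%:R + vside s / 3 * k%:R.
  rewrite /subcorner -addrA; congr (_ + _).
  have -> : hside s / 3 = (s / 3)%:C.
    by rewrite rmorphM /= rmorphV ?unitfE ?pnatr_eq0 // rmorph_nat.
  have -> : vside s / 3 = Complex 0 (s / 3).
    have -> : vside s = Complex 0 (s / 3) * 3.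
      rewrite -[3 : C](rmorph_nat (real_complex R)).
      by complex_eq; lra.
    by rewrite mulfK ?pnatr_eq0.
  rewrite -(rmorph_nat (real_complex R)) -(rmorph_nat (real_complex R)).
  by complex_eq; field.
rewrite /square_sum /= /H /V.
congr (trap m F _ _ + trap m F _ _ + trap m F _ _ +
       (trap m F _ _ + trap m F _ _ + trap m F _ _) -
       (trap m F _ _ + trap m F _ _ + trap m F _ _) -
       (trap m F _ _ + trap m F _ _ + trap m F _ _));
  by rewrite !pt; field.
Qed.

Lemma square_sumD m F G a s : square_sum m (fun z => F z + G z) a s =
  square_sum m F a s + square_sum m G a s.
Proof. by rewrite /square_sum !trapD; ring. Qed.

Lemma square_sumZ m (u : C) F a s :
  square_sum m (fun z => u * F z) a s = u * square_sum m F a s.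
Proof. by rewrite /square_sum !trapZ; ring. Qed.

Lemma square_sum_affine m (u v : C) a s :
  square_sum m (fun z => u + v * z) a s = 0.
Proof. by rewrite /square_sum !trap_affine; field. Qed.

Definition on_boundary a s z := in_square a s z /\
  [\/ Re z = Re a, Re z = Re a + s, Im z = Im a | Im z = Im a + s].

Lemma normc_hside s : 0 <= s -> normc (hside s) = s.
Proof. by move=> s0; rewrite /hside /= expr0n addr0 sqrtr_sqr ger0_norm. Qed.

Lemma normc_vside s : 0 <= s -> normc (vside s) = s.
Proof. by move=> s0; rewrite /vside /= expr0n add0r sqrtr_sqr ger0_norm. Qed.

Lemma hsideZ t s : t%:C * hside s = Complex (t * s) 0.
Proof. by rewrite /hside; complex_eq; ring. Qed.

Lemma vsideZ t s : t%:C * vside s = Complex 0 (t * s).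
Proof. by rewrite /vside; complex_eq; ring. Qed.

(** Perimeter times maximum, uniformly in the level [m]. *)
Lemma normc_square_sum m F a s (M : R) : 0 <= s ->
  (forall z, on_boundary a s z -> normc (F z) <= M) ->
  normc (square_sum m F a s) <= 4 * s * M.
Proof.
move=> s0 bound.
have ts t : 0 <= t -> t <= 1 -> 0 <= t * s <= s.
  by move=> t0 t1; rewrite mulr_ge0 //= ler_piMl.
have edge b v : normc v = s ->
    (forall t, 0 <= t -> t <= 1 -> on_boundary a s (b + t%:C * v)) ->
    normc (trap m F b (b + v)) <= s * M.
  move=> vs bv; rewrite -[X in X * M]vs; have := @normc_trap m F b (b + v) M.
  rewrite (_ : b + v - b = v); last by ring.
  by apply=> t t0 t1; apply: bound; apply: bv.
have h1 : normc (trap m F a (a + hside s)) <= s * M.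
  apply: edge; rewrite ?normc_hside // => t t0 t1; rewrite hsideZ.
  have /andP[? ?] := ts t t0 t1.
  by rewrite /on_boundary /in_square !ReD !ImD /=; split;
    [split; lra | apply: Or43; lra].
have h2 : normc (trap m F (a + vside s) (a + hside s + vside s)) <= s * M.
  rewrite addrAC; apply: edge; rewrite ?normc_hside // => t t0 t1; rewrite hsideZ.
  have /andP[? ?] := ts t t0 t1.
  by rewrite /on_boundary /in_square !ReD !ImD /=; split;
    [split; lra | apply: Or44; lra].
have v1 : normc (trap m F a (a + vside s)) <= s * M.
  apply: edge; rewrite ?normc_vside // => t t0 t1; rewrite vsideZ.
  have /andP[? ?] := ts t t0 t1.
  by rewrite /on_boundary /in_square !ReD !ImD /=; split;
    [split; lra | apply: Or41; lra].
have v2 : normc (trap m F (a + hside s) (a + hside s + vside s)) <= s * M.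
  apply: edge; rewrite ?normc_vside // => t t0 t1; rewrite vsideZ.
  have /andP[? ?] := ts t t0 t1.
  by rewrite /on_boundary /in_square !ReD !ImD /=; split;
    [split; lra | apply: Or42; lra].
have nB (x y : C) : normc (x - y) <= normc x + normc y.
  by apply: le_trans (le_normcD _ _) _; rewrite normcN.
rewrite /square_sum.
set p := trap m F _ _ in h1 *; set q := trap m F _ _ in v2 *.
set u := trap m F _ _ in h2 *; set v := trap m F _ _ in v1 *.
by have := nB (p + q - u) v; have := nB (p + q) u; have := le_normcD p q; lra.
Qed.

(** * Goursat's argument and shrinking of contours *)

Lemma le_normc_ReIm z : normc z <= `|Re z| + `|Im z|.
Proof.
case: z => x y /=; rewrite -[X in _ <= X]ger0_norm ?addr_ge0 // -sqrtr_sqr.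
rewrite ler_wsqrtr // sqrrD !real_normK ?num_real //.
by rewrite lerD2r lerDl mulrn_wge0 // mulr_ge0.
Qed.

Lemma normc_in_square a s z p : in_square a s z -> in_square a s p ->
  normc (z - p) <= 2 * s.
Proof.
move=> [? ? ? ?] [? ? ? ?].
apply: le_trans (le_normc_ReIm _) _; rewrite ReD ImD ReN ImN.
have -> : 2 * s = s + s by ring.
by apply: lerD; rewrite ler_norml; apply/andP; split; lra.
Qed.

(** Complex differentiability, phrased with the real-valued [normc] so that the estimates take place
    in [R]. *)
Definition cdiff F p := exists d : C, forall e : R, 0 < e ->
  exists2 r : R, 0 < r & forall z, normc (z - p) < r ->
    normc (F z - F p - d * (z - p)) <= e * normc (z - p).

Lemma normc_sum (I : finType) (f : I -> C) :
  normc (\sum_i f i) <= \sum_i normc (f i).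
Proof.
apply: (big_ind2 (fun x (y : R) => normc x <= y)) => //.
- by rewrite normc0.
- by move=> x1 x2 y1 y2 h1 h2; apply: le_trans (le_normcD _ _) (lerD h1 h2).
Qed.

(** On a small square around [p] the affine part of [F] contributes nothing and the remainder is
    bounded by a multiple of the area; such bounds add up over the nine cells. The threshold on [m]
    accounts for the levels spent on subdivisions. *)
Lemma square_sum_goursat F a s (e : R) : 0 < s -> 0 < e ->
  (forall p, in_square a s p -> cdiff F p) ->
  exists M, forall m, (M <= m)%N -> normc (square_sum m F a s) <= e * s ^+ 2.
Proof.
move=> s0 e0 dF.
apply: (square_cousin (P := fun a s => exists M, forall m, (M <= m)%N ->
  normc (square_sum m F a s) <= e * s ^+ 2)) => // [a' s' s'0 sub|p pin].
  have /choice[M MP] (jk : 'I_3 * 'I_3) : exists M, forall m, (M <= m)%N ->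
    normc (square_sum m F (subcorner a' s' jk.1 jk.2) (s' / 3)) <=
    e * (s' / 3) ^+ 2 by exact: sub.
  (* The successor pays for the level lost in [square_sumS]. *)
  exists (\max_jk M jk).+1 => -[//|m]; rewrite ltnS => mM.
  rewrite square_sumS pair_big /=.
  apply: le_trans (normc_sum _) _.
  apply: (@le_trans _ _ (\sum_(jk : 'I_3 * 'I_3) e * (s' / 3) ^+ 2)).
    apply: ler_sum => jk _; apply: MP; apply: leq_trans mM.
    exact: leq_bigmax.
  rewrite sumr_const card_prod card_ord -mulr_natl.
  by rewrite le_eqVlt; apply/orP; left; apply/eqP; field.
have [d dP] := dF p pin.
(* Points of a square of side [s'] are within [2 * s'] of each other, so the estimate is
   [4 * s' * (e / 8 * (2 * s'))], which is [e * s' ^+ 2]; side below [r / 2] keeps the square inside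
   the disc of radius [r]. *)
have [|r r0 rP] := dP (e / 8); first by lra.
exists (r / 2); first by lra.
move=> a' s' s'0 s'r pin' _; exists 0%N => m _.
have -> : F = fun z => (F p - d * p + d * z) + (F z - F p - d * (z - p)).
  by apply/funext => z; ring.
rewrite square_sumD square_sum_affine add0r.
have -> : e * s' ^+ 2 = 4 * s' * (e / 8 * (2 * s')) by field.
apply: normc_square_sum; first exact/ltW.
move=> z [zin _]; have zp := normc_in_square zin pin'.
apply: le_trans (rP _ _) _; first by lra.
by rewrite ler_wpM2l //; lra.
Qed.

Definition csquare_sum m F w (h : R) :=
  square_sum m F (w - Complex h h) (2 * h).

Lemma csquare_sumS F w (h e : R) : 0 < h -> 0 < e ->
  (forall p, in_square (w - Complex h h) (2 * h) p -> p != w -> cdiff F p) ->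
  exists M, forall m, (M <= m)%N ->
    normc (csquare_sum m.+1 F w h - csquare_sum m F w (h / 3)) <= e.
Proof.
move=> h0 e0 dF; pose a := w - Complex h h; pose s := 2 * h.
have s0 : 0 < s by rewrite /s; lra.
pose one : 'I_3 := @Ordinal 3 1 isT.
have /choice[M MP] (jk : 'I_3 * 'I_3) : exists M, forall m, (M <= m)%N ->
    jk != (one, one) ->
    normc (square_sum m F (subcorner a s jk.1 jk.2) (s / 3)) <= e / 9.
  have [->|jk1] := eqVneq jk (one, one); first by exists 0%N.
  have [||p pin|M MP] := @square_sum_goursat F (subcorner a s jk.1 jk.2) (s / 3)
     (e / 9 / (s / 3) ^+ 2).
  - by rewrite divr_gt0.
  - by rewrite !divr_gt0 // exprn_gt0 // divr_gt0.
  - apply: dF; first exact: in_square_sub (ltW s0) pin.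
    apply: contraNneq jk1 => pw; move: pin; rewrite pw.
    case: jk => -[[|[|[|//]]] ?] [[|[|[|//]]] ?] //=;
      by rewrite /in_square /subcorner /a /s !ReD !ImD !ReN !ImN /=
        => -[? ? ? ?]; exfalso; lra.
  - exists M => m mM _; apply: le_trans (MP _ mM) _.
    by rewrite divfK // expf_neq0 //; lra.
exists (\max_jk M jk) => m mM.
rewrite /csquare_sum -/a -/s square_sumS pair_big /= (bigD1 (one, one)) //=.
have -> : subcorner a s 1 1 = w - Complex (h / 3) (h / 3).
  by rewrite /subcorner /a /s -addrA; congr (w + _); complex_eq; field.
have -> : 2 * (h / 3) = s / 3 by rewrite /s; field.
rewrite [X in normc X]addrAC subrr add0r.
apply: le_trans (_ : \sum_(jk : 'I_3 * 'I_3) e / 9 <= _); last first.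
  rewrite sumr_const card_prod card_ord -mulr_natl.
  by rewrite le_eqVlt; apply/orP; left; apply/eqP; field.
rewrite big_mkcond; apply: le_trans (normc_sum _) _; apply: ler_sum => jk _.
case: ifPn => [jk1|_]; last by rewrite normc0 divr_ge0 // ltW.
by apply: MP => //; apply: leq_trans mM; exact: leq_bigmax.
Qed.

(** Discrete form of contour deformation: the contour is contracted towards the possible singularity
    [w] at the price of an arbitrarily small error. *)
Lemma csquare_sum_iter k F w (h e : R) : 0 < h -> 0 < e ->
  (forall p, in_square (w - Complex h h) (2 * h) p -> p != w -> cdiff F p) ->
  exists M, forall m, (M <= m)%N ->
    normc (csquare_sum (m + k) F w h - csquare_sum m F w (h / 3 ^+ k)) <= e.
Proof.
elim: k h e => [|k IH] h e h0 e0 dF.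
  by exists 0%N => m _; rewrite addn0 expr0 divr1 subrr normc0 ltW.
have [|||M1 M1P] := IH (h / 3) (e / 2); first by lra.
- by lra.
- move=> p pin; apply: dF; move: pin.
  by rewrite /in_square !ReD !ImD !ReN !ImN /= => -[? ? ? ?]; split; lra.
have [|M2 M2P] := csquare_sumS h0 (e := e / 2) _ dF; first by lra.
exists (maxn M1 M2) => m; rewrite geq_max => /andP[m1 m2].
have := M1P m m1; have := M2P (m + k)%N (leq_trans m2 (leq_addr _ _)).
rewrite addnS exprS invfM mulrA => n2 n1.
set x := csquare_sum _ _ _ _ in n2 *; set y := csquare_sum _ _ _ _ in n2 n1 *.
set z := csquare_sum _ _ _ _ in n1 *.
rewrite (_ : x - z = (x - y) + (y - z)); last by ring.
by have := le_normcD (x - y) (y - z); lra.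
Qed.

(** * The Cauchy kernel and Cauchy's estimate *)

Lemma Im_div b z : Im (b * z^-1) =
  (Im b * Re z - Re b * Im z) / (Re z ^+ 2 + Im z ^+ 2).
Proof. by case: b z => x y [u v] /=; ring. Qed.

Lemma Im_trap_ge m F b v (c : R) :
  (forall t, 0 <= t -> t <= 1 -> c <= Im (v * F (b + t%:C * v))) ->
  c <= Im (trap m F b (b + v)).
Proof.
move=> Fc; rewrite -lerN2.
apply: (@trap_sublinear (fun z => - Im z) m F b (b + v)).
- by move=> x y; rewrite ImD opprD.
- by move=> t [x y] _ /=; lra.
- by move=> t t0 t1; rewrite addrAC subrr add0r lerN2 Fc.
Qed.

Lemma Im_trap_le m F b v (c : R) :
  (forall t, 0 <= t -> t <= 1 -> Im (v * F (b + t%:C * v)) <= c) ->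
  Im (trap m F b (b + v)) <= c.
Proof.
move=> Fc; apply: (@trap_sublinear Im m F b (b + v)).
- by move=> x y; rewrite ImD.
- by move=> t [x y] _ /=; lra.
- by move=> t t0 t1; rewrite addrAC subrr add0r Fc.
Qed.

(** Substitute for the value [2 * pi * i] of the integral of the kernel. On each oriented side the
    integrand has imaginary part [2 * h ^+ 2 / (x ^+ 2 + h ^+ 2)] with [|x| <= h], hence at least 1,
    and the four sides add up. *)
Lemma normc_csquare_sum_inv m w (h : R) : 0 < h ->
  4 <= normc (csquare_sum m (fun z => (z - w)^-1) w h).
Proof.
move=> h0; set S := csquare_sum _ _ _ _.
have ge_Im : 4 <= Im S -> 4 <= normc S.
  case: S => x y /= y4; apply: le_trans y4 _.
  apply: le_trans (ler_norm _) _; rewrite -sqrtr_sqr ler_wsqrtr // lerDr.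
  exact: sqr_ge0.
apply: ge_Im; rewrite {}/S /csquare_sum /square_sum.
set F := fun z => _; set a := w - _; pose s := 2 * h.
have ratio x : - h <= x -> x <= h -> 1 <= 2 * h ^+ 2 / (x ^+ 2 + h ^+ 2).
  move=> xh hx; rewrite ler_pdivlMr; first by nra.
  by apply: ltr_wpDl; rewrite ?sqr_ge0 // exprn_gt0.
have ts t : 0 <= t -> t <= 1 -> 0 <= t * (2 * h) <= 2 * h.
  by move=> t0 t1; rewrite mulr_ge0 ?ler_piMl //; lra.
have h1 : 1 <= Im (trap m F a (a + hside (2 * h))).
  apply: Im_trap_ge => t t0 t1; have /andP[? ?] := ts t t0 t1.
  rewrite /F Im_div hsideZ /a !ReD !ImD !ReN !ImN /=.
  have := ratio (t * (2 * h) - h).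
  move=> /(_ ltac:(lra) ltac:(lra)) /le_trans; apply.
  by rewrite le_eqVlt; apply/orP; left; apply/eqP; congr (_ / _); ring.
have h2 : Im (trap m F (a + vside (2 * h)) (a + hside (2 * h) + vside (2 * h))) <= -1.
  rewrite (addrAC a); apply: Im_trap_le => t t0 t1; have /andP[? ?] := ts t t0 t1.
  rewrite /F Im_div hsideZ /a !ReD !ImD !ReN !ImN /=.
  have := ratio (t * (2 * h) - h).
  move=> /(_ ltac:(lra) ltac:(lra)); rewrite -lerN2; apply: le_trans.
  rewrite le_eqVlt; apply/orP; left; apply/eqP; rewrite -[RHS]mulNr.
  by congr (_ / _); ring.
have v1 : Im (trap m F a (a + vside (2 * h))) <= -1.
  apply: Im_trap_le => t t0 t1; have /andP[? ?] := ts t t0 t1.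
  rewrite /F Im_div vsideZ /a !ReD !ImD !ReN !ImN /=.
  have := ratio (t * (2 * h) - h).
  move=> /(_ ltac:(lra) ltac:(lra)); rewrite -lerN2; apply: le_trans.
  rewrite le_eqVlt; apply/orP; left; apply/eqP; rewrite -[RHS]mulNr.
  by congr (_ / _); ring.
have v2 : 1 <= Im (trap m F (a + hside (2 * h)) (a + hside (2 * h) + vside (2 * h))).
  apply: Im_trap_ge => t t0 t1; have /andP[? ?] := ts t t0 t1.
  rewrite /F Im_div vsideZ /a !ReD !ImD !ReN !ImN /=.
  have := ratio (t * (2 * h) - h).
  move=> /(_ ltac:(lra) ltac:(lra)) /le_trans; apply.
  by rewrite le_eqVlt; apply/orP; left; apply/eqP; congr (_ / _); ring.
rewrite !ImD !ImN.
by lra.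
Qed.

Lemma normc_gt0 z : z != 0 -> 0 < normc z.
Proof.
move=> z0; rewrite lt_neqAle normc_ge0 andbT eq_sym.
by apply: contra_neq z0 => /eq0_normc.
Qed.

Lemma ler_Re_normc z : `|Re z| <= normc z.
Proof.
by case: z => x y /=; rewrite -sqrtr_sqr ler_wsqrtr // lerDl sqr_ge0.
Qed.

Lemma ler_Im_normc z : `|Im z| <= normc z.
Proof.
by case: z => x y /=; rewrite -sqrtr_sqr ler_wsqrtr // lerDr sqr_ge0.
Qed.

Lemma boundary_dist w (h : R) z : 0 < h ->
  on_boundary (w - Complex h h) (2 * h) z -> h <= normc (z - w).
Proof.
move=> h0 [_]; rewrite !ReD !ImD !ReN !ImN /=.
have := ler_Re_normc (z - w); have := ler_Im_normc (z - w).
rewrite ReD ImD ReN ImN; have := ler_norm (Re z - Re w).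
have := ler_norm (Im z - Im w); have := ler_norm (- (Re z - Re w)).
have := ler_norm (- (Im z - Im w)); rewrite !normrN => ? ? ? ? ? ?.
by case=> ?; lra.
Qed.

Lemma cdiff_cont F p (e : R) : cdiff F p -> 0 < e ->
  exists2 r : R, 0 < r & forall z, normc (z - p) < r -> normc (F z - F p) <= e.
Proof.
move=> [d dP] e0; have [r r0 rP] := dP 1 ltr01.
have D0 : 0 < 1 + normc d by have := normc_ge0 d; lra.
exists (Num.min r (e / (1 + normc d))).
  by rewrite lt_min r0 divr_gt0.
move=> z; rewrite lt_min ltr_pdivlMr // => /andP[/rP zr ze].
have := le_normcD (F z - F p - d * (z - p)) (d * (z - p)).
rewrite subrK normcM => /le_trans; apply.
by apply: le_trans (lerD zr (lexx _)) _; lra.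
Qed.

(** On the large contour the sum of [G z / (z - w)] is at most the perimeter [8 * h] times [B / h].
    On a tiny one it is [G w] times the kernel sum, of modulus at least 4, up to [2 * e].
    Contraction costs [e], so [4 * normc (G w) <= 8 * B + 3 * e]. *)
Lemma cauchy_estimate G w (h B : R) : 0 < h ->
  (forall p, in_square (w - Complex h h) (2 * h) p -> p != w ->
     cdiff (fun z => G z * (z - w)^-1) p) ->
  cdiff G w ->
  (forall z, on_boundary (w - Complex h h) (2 * h) z -> normc (G z) <= B) ->
  normc (G w) <= 2 * B.
Proof.
move=> h0 dF dG bound; apply/ler_addgt0Pr => e e0.
pose F := fun z => G z * (z - w)^-1.
have [|r r0 rP] := cdiff_cont dG (e := e / 4); first by lra.
(* Chosen so that the contracted square has diameter below [r], where [G] is within [e / 4] of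
   [G w]. *)
have [k hk] := expr3_gt (2 * h * 2 / r).
pose q := h / 3 ^+ k; have q0 : 0 < q by rewrite divr_gt0 // exprn_gt0.
have qr : 2 * (2 * q) < r.
  move: hk; rewrite ltr_pdivrMr // /q => hk.
  rewrite mulrA (mulrA (2 * 2)) ltr_pdivrMr ?exprn_gt0 //; lra.
have [M MP] := csquare_sum_iter k h0 e0 dF.
have {MP} := MP M (leqnn M); rewrite -/q.
have big : normc (csquare_sum (M + k) F w h) <= 8 * B.
  have -> : 8 * B = 4 * (2 * h) * (B / h).
    by rewrite mulrA -!mulrA; field; rewrite gt_eqF.
  apply: normc_square_sum; first by lra.
  move=> z zb; have zw := boundary_dist h0 zb.
  rewrite /F normcM normcV; apply: ler_pM; rewrite ?invr_ge0 ?normc_ge0 //.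
  - exact: bound.
  - by rewrite lef_pV2 // posrE; lra.
have FE : F = fun z => G w * (z - w)^-1 + (G z - G w) * (z - w)^-1.
  by apply/funext => z; rewrite /F; ring.
have small : normc (csquare_sum M (fun z => (G z - G w) * (z - w)^-1) w q) <= 2 * e.
  have -> : 2 * e = 4 * (2 * q) * (e / 4 / q) by field; rewrite gt_eqF.
  apply: normc_square_sum; first by lra.
  move=> z zb; have zw := boundary_dist q0 zb.
  rewrite normcM normcV; apply: ler_pM; rewrite ?invr_ge0 ?normc_ge0 //.
  - apply: rP; apply: le_lt_trans qr; apply: normc_in_square zb.1 _.
    by rewrite /in_square !ReD !ImD !ReN !ImN /=; split; lra.
  - by rewrite lef_pV2 // posrE; lra.
have main : csquare_sum M F w q = G w * csquare_sum M (fun z => (z - w)^-1) w q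
    + csquare_sum M (fun z => (G z - G w) * (z - w)^-1) w q.
  by rewrite FE /csquare_sum square_sumD square_sumZ.
have K4 := normc_csquare_sum_inv M w q0.
move: main big small K4.
set S := csquare_sum _ F w h; set S' := csquare_sum M F w q.
set K := csquare_sum _ _ _ _; set T := csquare_sum _ _ _ _ => main big small K4 near.
have : 4 * normc (G w) <= normc (G w * K).
  by rewrite normcM mulrC ler_wpM2l ?normc_ge0.
have -> : G w * K = S + (- (S - S') + - T) by rewrite main; ring.
have := le_normcD S (- (S - S') + - T); have := le_normcD (- (S - S')) (- T).
by rewrite !normcN; lra.
Qed.

(** * Unique continuation *)

Lemma differentiable_cdiff (F : C^o -> C^o) (p : C^o) :
  differentiable F p -> cdiff F p.
Proof.
move=> dF; exists ('d F p 1) => e e0.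
have /eqaddoP/(_ e%:C) := diff_locally dF.
rewrite ltcR => /(_ e0) /nbhs_ballP[r /= r0 rP].
have rE : (Re r)%:C = r by apply: RRe_real; exact: gtr0_real.
exists (Re r); first by rewrite -ltcR rE.
move=> z zr; have := rP (z - p); rewrite -ball_normE /= sub0r normrN.
have zrC : `|z - p| < r by rewrite -rE -[`|_|]/(normc (z - p))%:C ltcR.
move=> /(_ zrC); rewrite !fctE /= subrK.
rewrite -lecR rmorphM /=.
have -> : 'd F p (z - p) = 'd F p 1 * (z - p).
  rewrite -[X in 'd F p X]mulr1 -[X in 'd F p X]/((z - p) *: (1 : C^o)).
  by rewrite linearZ /= mulrC.
by rewrite opprD addrA.
Qed.

Lemma cdiff_near0 F p (r : R) : 0 < r ->
  (forall z, normc (z - p) < r -> F z = 0) -> cdiff F p.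
Proof.
move=> r0 F0; exists 0 => e e0; exists r => // z zr.
have -> : F p = 0 by apply: F0; rewrite subrr normc0.
rewrite F0 // mul0r !subr0 normc0.
by rewrite mulr_ge0 ?normc_ge0 // ltW.
Qed.

(** Continuity bounds [F] near each point, and finitely many bounds combine into one;
    [square_cousin] makes this global. *)
Lemma square_bounded F a s : 0 < s ->
  (forall p, in_square a s p -> cdiff F p) ->
  exists M : R, forall z, in_square a s z -> normc (F z) <= M.
Proof.
move=> s0 dF.
apply: (square_cousin (P := fun a s => exists M : R, forall z,
  in_square a s z -> normc (F z) <= M)) => // [a' s' s'0 sub|p pin].
  have /choice[M MP] (jk : 'I_3 * 'I_3) : exists M : R, forall z,
    in_square (subcorner a' s' jk.1 jk.2) (s' / 3) z -> normc (F z) <= M.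
    exact: sub.
  exists (\sum_jk `|M jk|) => z [? ? ? ?].
  have third (x y : R) : x <= y -> y <= x + s' -> exists j : 'I_3,
      x + (j : nat)%:R * (s' / 3) <= y <= x + (j : nat)%:R * (s' / 3) + s' / 3.
    move=> xy yx; have [y1|y1] := leP y (x + s' / 3).
      by exists (@Ordinal 3 0 isT) => /=; lra.
    have [y2|y2] := leP y (x + 2 * (s' / 3)).
      by exists (@Ordinal 3 1 isT) => /=; lra.
    by exists (@Ordinal 3 2 isT) => /=; lra.
  have [j /andP[? ?]] := third (Re a') (Re z) ltac:(assumption) ltac:(assumption).
  have [k /andP[? ?]] := third (Im a') (Im z) ltac:(assumption) ltac:(assumption).
  apply: le_trans (MP (j, k) z _) _.
    by rewrite /in_square /subcorner ReD ImD.
  apply: le_trans (ler_norm _) _.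
  by rewrite (bigD1 (j, k)) //= lerDl sumr_ge0.
have [r r0 rP] := cdiff_cont (dF p pin) ltr01.
exists (r / 2); first by lra.
move=> a' s' s'0 s'r pin' _; exists (1 + normc (F p)) => z zin.
have := rP z _; have := le_normcD (F z - F p) (F p); rewrite subrK.
by have := normc_in_square zin pin'; move=> h1 h2 /(_ ltac:(lra)); lra.
Qed.

Lemma differentiable_exprV n (p : C^o) : p != 0 ->
  differentiable (fun z : C^o => z^-1 ^+ n : C^o) p.
Proof.
move=> p0; elim: n => [|n IH]; first exact: differentiable_cst.
under eq_fun do rewrite exprS.
by apply: differentiableM => //; exact: differentiable_Rinv.
Qed.

Lemma disc_unique_continuation (F : C^o -> C^o) (r : R) : 0 < r ->
  (forall z : C^o, normc z < 10 -> differentiable F z) ->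
  (forall z, normc z < r -> F z = 0) -> F 1 = 0.
Proof.
move=> r0 dF F0.
(* Here [|Re z| <= 5] and [|Im z| <= 4], so the square stays in the disc of radius 10. *)
pose Q := in_square (1 - Complex 4 4) (2 * 4).
have Q10 p : Q p -> normc p < 10.
  rewrite /Q /in_square ReD ImD ReN ImN /= => -[? ? ? ?].
  apply: le_lt_trans (le_normc_ReIm _) _.
  have : `|Re p| <= 5 by rewrite ler_norml; lra.
  have : `|Im p| <= 4 by rewrite ler_norml; lra.
  by lra.
have [||M MP] := square_bounded (F := F) (a := 1 - Complex 4 4) (s := 2 * 4).
- by lra.
- by move=> p /Q10 /dF /differentiable_cdiff.
pose G n := fun z : C^o => F z * (z^-1) ^+ n : C^o.
have dG n p : Q p -> cdiff (G n) p.
  move=> /Q10 /dF dFp.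
  (* The factor [F] vanishes near 0, so the conventional value of the inverse at 0 does no harm. *)
  have [->|p0] := eqVneq p 0.
    by apply: (cdiff_near0 r0) => z; rewrite subr0 /G => /F0 ->; rewrite mul0r.
  apply: differentiable_cdiff; apply: differentiableM => //.
  exact: differentiable_exprV.
have dGF n p : Q p -> p != 1 -> cdiff (fun z => G n z * (z - 1)^-1) p.
  move=> /Q10 /dF dFp p1.
  have [->|p0] := eqVneq p 0.
    by apply: (cdiff_near0 r0) => z; rewrite subr0 /G => /F0 ->; rewrite !mul0r.
  apply: (@differentiable_cdiff (fun z : C^o => G n z * (z - 1)^-1)).
  apply: differentiableM.
    apply: differentiableM => //.
    exact: differentiable_exprV.
  apply: differentiableV; last by rewrite subr_eq0.
  exact: differentiableB.
have est n : normc (F 1) * 3 ^+ n <= 2 * M.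
  have -> : normc (F 1) = normc (G n 1) by rewrite /G invr1 expr1n mulr1.
  rewrite -ler_pdivlMr ?exprn_gt0 // -mulrA.
  apply: (@cauchy_estimate (G n) 1 4) => //.
  - exact: dGF.
  - by apply: dG; rewrite /Q /in_square ReD ImD ReN ImN /=; split; lra.
  (* The side nearest to 0 is the left one, on [Re z = -3]; the others lie at distance 4 or 5. *)
  - move=> z zb; have z3 : 3 <= normc z.
      case: zb => _; rewrite ReD ImD ReN ImN /=.
      have := ler_Re_normc z; have := ler_Im_normc z.
      have := ler_norm (Re z); have := ler_norm (Im z).
      have := ler_norm (- Re z); have := ler_norm (- Im z); rewrite !normrN.
      by move=> ? ? ? ? ? ?; case=> ?; lra.
    rewrite /G normcM; apply: ler_pM; rewrite ?normc_ge0 //; first exact: MP zb.1.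
    elim: n => [|n IH]; first by rewrite !expr0 normc1 invr1.
    rewrite !exprS normcM invfM normcV.
    apply: ler_pM; rewrite ?normc_ge0 ?invr_ge0 ?normc_ge0 //.
    by rewrite lef_pV2 ?posrE //; lra.
apply: contrapT => /eqP /normc_gt0 F1.
have [n] := expr3_gt (2 * M / normc (F 1)).
by rewrite ltr_pdivrMr // (mulrC (3 ^+ n)) ltNge est.
Qed.

End CauchyEstimate.

(** Isolated as a property of the field so that the arguments on germs can be carried out over a
    generic [K]. The points 0 and 1 will parametrize the two ends of a segment of a complex line. *)
Definition unique_continuation (K : numFieldType) := forall F : K^o -> K^o,
  (forall z : K^o, `|z| < 10 -> differentiable F z) ->
  (\forall z \near (0 : K^o), F z = 0) -> F 1 = 0.

Lemma complex_unique_continuation (R : realType) : unique_continuation R[i].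
Proof.
move=> F dF /nbhs_ballP[r /= r0 rP].
have rE : (complex.Re r)%:C%C = r by apply: RRe_real; exact: gtr0_real.
apply: (@disc_unique_continuation R F (complex.Re r)).
- by rewrite -ltcR rE.
- move=> z z10; apply: dF.
  by rewrite -[`|_|]/((normc z)%:C%C) -(rmorph_nat (real_complex R)) ltcR.
- move=> z zr; apply: rP; rewrite -ball_normE /= sub0r normrN -rE.
  by rewrite -[`|_|]/((normc z)%:C%C) ltcR.
Qed.

(** * Germs of holomorphic functions form an integral domain *)

Section GermDomain.
Variable K : numFieldType.
Hypothesis Kuc : unique_continuation K.
Implicit Types (a b z : 'rV[K]_2).

Lemma line_unique_continuation (g : 'rV[K]_2 -> K^o) a b :
  (forall t : K^o, `|t| < 10 -> differentiable g (a + t *: (b - a))) ->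
  (\forall z \near a, g z = 0) -> g b = 0.
Proof.
move=> dg g0.
pose line (t : K^o) := a + t *: (b - a).
have dline t : differentiable line t.
  apply: differentiableD; first exact: differentiable_cst.
  exact: differentiableZl.
have -> : b = line 1 by rewrite /line scale1r addrC subrK.
apply: (Kuc (F := g \o line)) => [t t10|].
  by apply: differentiable_comp => //; exact: dg.
have /differentiable_continuous cl := dline 0.
have line0 : line 0 = a by rewrite /line scale0r addr0.
by have /(_ [set z | g z = 0]%classic) := cl; apply; rewrite line0.
Qed.

(** Arbitrarily close to 0 there is a point [a] with [f a != 0]. By continuity [g] vanishes around
    [a], and the complex line from [a] to any [b] near 0 carries this vanishing to [b]. *)
Lemma germ_mul_eq0 (f g : 'rV[K]_2 -> K^o) : holo_germ f -> holo_germ g ->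
  (fun z => f z * g z) =0= (fun=> 0) -> ~ (f =0= (fun=> 0)) -> g =0= (fun=> 0).
Proof.
move=> df dg fg nf.
have : \forall z \near (0 : 'rV[K]_2), [/\ differentiable f z, differentiable g z
    & \forall y \near z, f y * g y = 0].
  near=> z; split; first by near: z.
    by near: z.
  by near: z; apply: nbhs_interior fg.
move=> /nbhs_ballP[r /= r0 rP].
(* With [a] and [b] of norm below [r / 22] and [|t| < 10], the point [a + t *: (b - a)] has norm
   below [(1 + 10 * 2) * r / 22], hence below [r]. *)
have r22 : 0 < r / 22 by rewrite divr_gt0.
have rP' z : `|z| < r -> [/\ differentiable f z, differentiable g z
    & \forall y \near z, f y * g y = 0].
  by move=> zr; apply: rP; rewrite -ball_normE /= sub0r normrN.
have rr : r / 22 < r by rewrite ltr_pdivrMr // ltr_pMr // ltr1n.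
have [a ar fa] : exists2 a, `|a| < r / 22 & f a != 0.
  apply: contrapT => noa; apply: nf; apply/nbhs_ballP; exists (r / 22) => // z /=.
  rewrite -ball_normE /= sub0r normrN => zr.
  by apply: contrapT => /eqP fz; apply: noa; exists z.
have ga : \forall z \near a, g z = 0.
  have [/differentiable_continuous cf _ fga] := rP' a (lt_trans ar rr).
  have fn0 : \forall z \near a, f z != 0 by exact: cvgr_neq0 cf fa.
  near=> z; have /eqP : f z * g z = 0 by near: z.
  rewrite mulf_eq0 => /orP[fz|/eqP//].
  by have : f z != 0 by [near: z]; rewrite fz.
apply/nbhs_ballP; exists (r / 22) => // b.
rewrite -ball_normE /= sub0r normrN => br.
apply: (line_unique_continuation (a := a)) => // t t10.
suff /rP'[] : `|a + t *: (b - a)| < r by [].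
apply: le_lt_trans (ler_normD _ _) _.
rewrite normrZ.
have ba : `|b - a| < r / 22 + r / 22.
  by apply: le_lt_trans (ler_normB _ _) _; exact: ltrD.
have : `|t| * `|b - a| <= 10 * (r / 22 + r / 22) by apply: ler_pM => //; exact: ltW.
move=> /(ltr_leD ar) /lt_le_trans; apply.
have -> : r / 22 + 10 * (r / 22 + r / 22) = r * (21 / 22) by field.
by rewrite ger_pMr // ler_pdivrMr // mul1r ler_nat.
Unshelve. all: by end_near. Qed.

End GermDomain.

(** * Commuting vector fields *)

(** The differential of [f] provides a first order expansion of [g], and such expansions are unique.
    This allows a representative of a germ to be replaced. *)
Lemma near_eq_differentiable (K : numFieldType) (V W : normedModType K)
    (f g : V -> W) (x : V) :
  {near x, f =1 g} -> differentiable f x -> differentiable g x.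
Proof.
move=> fg df.
have gE : g \o shift x = cst (g x) + 'd f x +o_ (0 : V) id.
  apply/eqaddoP => e e0; have /eqaddoP/(_ e e0) := diff_locally df.
  have fg0 : \forall h \near (0 : V), f (h + x) = g (h + x).
    by have := fg; rewrite (near_shift 0 x); apply: filterS => h /=; rewrite subr0.
  by apply: filterS2 fg0 => h /= fgh; rewrite !fctE /= fgh (nbhs_singleton fg).
have dE := diff_unique (diff_continuous df) gE.
by apply/diff_locallyP; split; rewrite dE //; exact: diff_continuous.
Qed.

Section Plane.
Variable K : numFieldType.
Implicit Types (X Y : 'rV[K]_2 -> 'rV[K]_2) (f g : 'rV[K]_2 -> K^o).
Implicit Types (z v : 'rV[K]_2) (i j : 'I_2).

Definition component X i : 'rV[K]_2 -> K^o := fun z => X z 0 i.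

Definition partial j f z : K := 'D_(delta_mx 0 j) f z.

Lemma differentiable_component X i z :
  differentiable X z -> differentiable (component X i) z.
Proof.
move=> dX; apply: (@differentiable_comp _ _ _ _ X (fun v => v 0 i : K^o)) => //.
exact: differentiable_coord.
Qed.

Lemma derive_partial f z v : differentiable f z ->
  'D_v f z = v 0 0 * partial 0 f z + v 0 1 * partial 1 f z.
Proof.
move=> df; rewrite /partial !deriveE // {1}(row_sum_delta v).
rewrite linear_sum big_ord_recl big_ord1 /= !linearZ.
by have -> : lift ord0 ord0 = 1 :> 'I_2 by exact: val_inj.
Qed.

Lemma derive_component X i z v : differentiable X z ->
  ('D_v X z) 0 i = 'D_v (component X i) z.
Proof.
move=> dX; rewrite !deriveE //; last exact: differentiable_component.
have dc : differentiable (fun v : 'rV[K]_2 => v 0 i : K^o) (X z).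
  exact: differentiable_coord.
have -> : component X i = (fun v : 'rV[K]_2 => v 0 i : K^o) \o X by [].
rewrite (@diff_comp _ _ _ _ X (fun v : 'rV[K]_2 => v 0 i : K^o)) //=.
have lc : linear (fun v : 'rV[K]_2 => v 0 i : K^o) by move=> a u w; rewrite !mxE.
(* The coordinate is packaged as a linear map into [K^o], so that it is its own differential. *)
pose cM := GRing.isLinear.Build K 'rV[K]_2 K^o _ (fun v : 'rV[K]_2 => v 0 i) lc.
pose c : {linear 'rV[K]_2 -> K^o} := HB.pack (fun v : 'rV[K]_2 => v 0 i) cM.
have -> // : 'd (fun v : 'rV[K]_2 => v 0 i : K^o) (X z) = c :> (_ -> _).
by apply: (@diff_lin _ _ _ c); exact: coord_continuous.
Qed.

Lemma bracket_component X Y z i : differentiable X z -> differentiable Y z ->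
  lie_bracket X Y z = 0 -> 'D_(X z) (component Y i) z = 'D_(Y z) (component X i) z.
Proof.
move=> dX dY /(congr1 (fun v : 'rV[K]_2 => v 0 i)).
by rewrite /lie_bracket !mxE !derive_component // => /eqP; rewrite subr_eq0 => /eqP.
Qed.

Lemma derive_quotient f g z v : differentiable f z -> differentiable g z ->
  g z != 0 -> 'D_v (fun y => f y / g y : K^o) z =
  ('D_v f z * g z - f z * 'D_v g z) / g z ^+ 2.
Proof.
move=> df dg gz.
have df' := diff_derivable (v := v) df; have dg' := diff_derivable (v := v) dg.
have := deriveM (f := f) (g := fun y => (g y)^-1) (v := v) df' (derivableV gz dg').
rewrite (deriveV gz dg') => ->.
by rewrite /GRing.scale /=; field.
Qed.

Definition det2 X Y : 'rV[K]_2 -> K^o :=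
  fun z => X z 0 0 * Y z 0 1 - X z 0 1 * Y z 0 0.

Lemma differentiable_det2 X Y z : differentiable X z -> differentiable Y z ->
  differentiable (det2 X Y) z.
Proof.
move=> dX dY; apply: differentiableB; apply: differentiableM;
  exact: differentiable_component.
Qed.

Lemma derive_det2 X Y z v : differentiable X z -> differentiable Y z ->
  'D_v (det2 X Y) z =
    'D_v (component X 0) z * Y z 0 1 + X z 0 0 * 'D_v (component Y 1) z
    - ('D_v (component X 1) z * Y z 0 0 + X z 0 1 * 'D_v (component Y 0) z).
Proof.
move=> dX dY.
have d Z i : differentiable Z z -> derivable (component Z i) z v.
  by move=> dZ; apply: diff_derivable; exact: differentiable_component.
have -> : det2 X Y = component X 0 * component Y 1 - component X 1 * component Y 0 by [].
rewrite deriveB; [|by apply: derivableM; apply: d..].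
rewrite !deriveM; [|by apply: d..].
by rewrite /GRing.scale /= /component; ring.
Qed.

Lemma holo_component X i : holo_germ X -> holo_germ (component X i).
Proof. by move=> dX; near=> z; apply: differentiable_component; near: z.
Unshelve. all: by end_near. Qed.

Lemma holo_det2 X Y : holo_germ X -> holo_germ Y -> holo_germ (det2 X Y).
Proof. by move=> dX dY; near=> z; apply: differentiable_det2; near: z.
Unshelve. all: by end_near. Qed.

(* [X(det2 X Y) = div X * det2 X Y] when X and Y commute. *)
Lemma derive_det2_commuting X Y z : differentiable X z -> differentiable Y z ->
  lie_bracket X Y z = 0 ->
  X z 0 0 * partial 0 (det2 X Y) z + X z 0 1 * partial 1 (det2 X Y) z =
  (partial 0 (component X 0) z + partial 1 (component X 1) z) * det2 X Y z.
Proof.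
move=> dX dY XY; rewrite -derive_partial; last exact: differentiable_det2.
rewrite derive_det2 // !(bracket_component _ dX dY XY).
rewrite !derive_partial; try exact: differentiable_component.
by rewrite /det2; ring.
Qed.

(** The form is [(X_1 dx - X_0 dy) / det2 X Y]. It is not zero, since its coefficients can both
    vanish only where [X], and with it the determinant, does. *)
Lemma liouvillian_of_commuting X Y : holo_germ X -> centralizer X Y ->
  ~ (det2 X Y =0= (fun=> 0)) -> liouvillian_integrable X.
Proof.
move=> dX [dY XY] nd.
have dX1 := holo_component 1 dX.
have dX0 : holo_germ (fun z => - component X 0 z : K^o).
  have := holo_component 0 dX; apply: filterS => z; exact: differentiableN.
pose a := MeroForm (MeroGerm dX1 (holo_det2 dX dY) nd)
  (MeroGerm dX0 (holo_det2 dX dY) nd).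
exists a; split.
- near=> z => /andP[/= dz _]; rewrite /mero_fun /=.
  have dXz : differentiable X z by near: z.
  have dYz : differentiable Y z by near: z.
  have XYz : lie_bracket X Y z = 0 by near: z.
  have d0 := differentiable_component 0 dXz.
  have d1 := differentiable_component 1 dXz.
  have dd := differentiable_det2 dXz dYz.
  rewrite !derive_quotient //; last exact: differentiableN.
  have -> : 'D_(delta_mx 0 0) (fun y => - component X 0 y : K^o) z =
      - partial 0 (component X 0) z.
    by rewrite (deriveN (f := component X 0)) //; exact: diff_derivable.
  have := derive_det2_commuting dXz dYz XYz.
  rewrite -/(partial 0 (det2 X Y) z) -/(partial 1 (det2 X Y) z).
  rewrite -/(partial 1 (component X 1) z) {1 2}/component => E.
  (* Over the common denominator, the numerator is [X(det2 X Y)] minus the divergence times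
     [det2 X Y], which [E] makes zero. *)
  rewrite -mulrBl; apply/eqP; rewrite mulf_eq0; apply/orP; left; apply/eqP.
  set div := partial 0 (component X 0) z + partial 1 (component X 1) z in E *.
  rewrite -[RHS](subrr (div * det2 X Y z)) -[X in _ = X - _]E /div /component.
  ring.
- move=> a0; apply: (nd); near=> z; apply: contrapT => /eqP dz.
  have : form_regular a z by rewrite /form_regular /= dz.
  have /[apply] : form_regular a z -> mero_fun (form_dx a) z = 0 /\
    mero_fun (form_dy a) z = 0 by near: z.
  rewrite /mero_fun /= => -[/eqP + /eqP].
  rewrite !mulf_eq0 oppr_eq0 !invr_eq0 (negPf dz) !orbF => /eqP x1 /eqP x0.
  move: dz; rewrite /det2 -[X z 0 0]/(component X 0 z).
  by rewrite -[X z 0 1]/(component X 1 z) x0 x1 !mul0r subrr eqxx.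
- by near=> z => _; rewrite /mero_fun /= /component; ring.
Unshelve. all: by end_near. Qed.

End Plane.

(** * Collinear commuting fields, wedge products and free families *)

Section Rank.
Variable K : numFieldType.
Hypothesis Kuc : unique_continuation K.
Implicit Types (X Y : 'rV[K]_2 -> 'rV[K]_2) (z : 'rV[K]_2).

Lemma ord2_cases (i : 'I_2) : i = 0 \/ i = 1.
Proof. by case: i => -[|[|//]] ?; [left|right]; exact: val_inj. Qed.

Lemma germ_component_neq0 X : ~ (X =0= (fun=> 0)) ->
  exists i, ~ (component X i =0= (fun=> 0)).
Proof.
move=> X0; apply: contrapT => noi; apply: X0.
have Xi i : component X i =0= (fun=> 0).
  by apply: contrapT => Xi; apply: noi; exists i.
near=> z; apply/rowP => i; rewrite mxE.
have X0z : component X 0 z = 0 by near: z; exact: Xi.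
have X1z : component X 1 z = 0 by near: z; exact: Xi.
by case: (ord2_cases i) => ->.
Unshelve. all: by end_near. Qed.

Lemma det2_eq0 X Y z (i j : 'I_2) : det2 X Y z = 0 ->
  X z 0 i * Y z 0 j = Y z 0 i * X z 0 j.
Proof.
rewrite /det2 => /subr0_eq d.
case: (ord2_cases i) => ->; case: (ord2_cases j) => ->; try by rewrite mulrC.
  by rewrite d mulrC.
by rewrite -d mulrC.
Qed.

(** Collinearity passes through a nonzero [X]: the product [X_i * det2 Y Y'] equals
    [Y_i * det2 X Y'], which is zero, and [X_i] can be cancelled. *)
Lemma germ_det2_trans X Y Y' : holo_germ X -> holo_germ Y -> holo_germ Y' ->
  ~ (X =0= (fun=> 0)) -> det2 X Y =0= (fun=> 0) -> det2 X Y' =0= (fun=> 0) ->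
  det2 Y Y' =0= (fun=> 0).
Proof.
move=> dX dY dY' /germ_component_neq0[i Xi] XY XY'.
apply: (germ_mul_eq0 Kuc (holo_component i dX) (holo_det2 dY dY')) => //.
near=> z; rewrite /component {1}/det2 mulrBr !mulrA.
have XYz : det2 X Y z = 0 by near: z.
have XYz' : det2 X Y' z = 0 by near: z.
rewrite !(det2_eq0 i _ XYz) -!mulrA ![X z 0 _ * _]mulrC.
have /subr0_eq E := XYz'.
by rewrite mulrC [X in _ - Y z 0 i * X]mulrC -E; ring.
Unshelve. all: by end_near. Qed.

Lemma first_integral_of_commuting X Y : holo_germ X -> centralizer X Y ->
  ~ (X =0= (fun=> 0)) -> det2 X Y =0= (fun=> 0) ->
  (forall c : K, ~ (Y =0= (fun z => c *: X z))) ->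
  exists f : mero_germ K, first_integral X f /\ ~ mero_const f.
Proof.
move=> dX [dY XY] /germ_component_neq0[i Xi] d0 nc.
exists (MeroGerm (holo_component i dY) (holo_component i dX) Xi); split.
  near=> z => /= Xz; rewrite /mero_fun /=.
  have dXz : differentiable X z by near: z.
  have dYz : differentiable Y z by near: z.
  have XYz : lie_bracket X Y z = 0 by near: z.
  have d0z : det2 X Y z = 0 by near: z.
  have dXi := differentiable_component i dXz.
  rewrite derive_quotient //; last exact: differentiable_component.
  rewrite (bracket_component _ dXz dYz XYz) !derive_partial //.
  rewrite /component in Xz *.
  (* The numerator is [Y(X_i) * X_i - Y_i * X(X_i)], which vanishes because [X_i Y = Y_i X] by
     collinearity. *)
  apply/eqP; rewrite mulf_eq0; apply/orP; left; apply/eqP.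
  have e0 := det2_eq0 i 0 d0z; have e1 := det2_eq0 i 1 d0z.
  rewrite mulrDr !mulrA -e0 -e1; ring.
move=> [c] /= fc; apply: (nc c).
(* The ratio is controlled only where [X_i] is nonzero; multiplying by [X_i] gives an identity valid
   everywhere near 0, and [X_i] is then cancelled. *)
have Yj j : (fun z => component Y j z - c * component X j z : K^o) =0= (fun=> 0).
  apply: (germ_mul_eq0 Kuc (holo_component i dX)) => //.
    near=> z; apply: differentiableB.
      by apply: differentiable_component; near: z.
    apply: (@differentiableZ _ _ _ (component X j)).
    by apply: differentiable_component; near: z.
  near=> z; have [->|Xz] := eqVneq (component X i z) 0; first by rewrite mul0r.
  have d0z : det2 X Y z = 0 by near: z.
  have YXc : component X i z != 0 -> component Y i z / component X i z = c.
    by near: z.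
  have Yi : component Y i z = c * component X i z by rewrite -(YXc Xz) divfK.
  move: (det2_eq0 i j d0z) Yi; rewrite /component => e Yi.
  by rewrite mulrBr e Yi; ring.
near=> z; apply/rowP => j; rewrite mxE.
have h0 : component Y 0 z - c * component X 0 z = 0 by near: z; exact: Yj.
have h1 : component Y 1 z - c * component X 1 z = 0 by near: z; exact: Yj.
by case: (ord2_cases j) => ->; [move/subr0_eq: h0|move/subr0_eq: h1].
Unshelve. all: by end_near. Qed.

Lemma det_mx2 (A : 'M[K]_2) : \det A = A 0 0 * A 1 1 - A 0 1 * A 1 0.
Proof.
rewrite (expand_det_row _ 0) big_ord_recl big_ord1 /cofactor !det_mx11 !mxE /=.
have -> : lift ord0 (ord0 : 'I_1) = 1 :> 'I_2 by exact: val_inj.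
have -> : lift 1 (0 : 'I_1) = 0 :> 'I_2 by exact: val_inj.
by rewrite /bump leqnn /= !addn0 expr0 expr1; ring.
Qed.

(** By the pigeonhole principle two columns of the matrix coincide. *)
Lemma wedge_gt2 n (Y : 'I_n -> 'rV[K]_2 -> 'rV[K]_2) s :
  (2 < n)%N -> wedge Y s =0= (fun=> 0).
Proof.
move=> n2; have /injectivePn[i [j ij sij]] : ~~ injectiveb s.
  by apply/injectiveP => /leq_card; rewrite !card_ord leqNgt n2.
near=> z.
by rewrite /wedge -det_tr (determinant_alternate ij) // => k; rewrite !mxE sij.
Unshelve. all: by end_near. Qed.

Lemma wedge2 (Y : 'I_2 -> 'rV[K]_2 -> 'rV[K]_2) s :
  det2 (Y 0) (Y 1) =0= (fun=> 0) -> wedge Y s =0= (fun=> 0).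
Proof.
apply: filterS => z /(det2_eq0 (s 0) (s 1)) e.
by rewrite /wedge det_mx2 !mxE e [X in _ - X]mulrC subrr.
Qed.

Lemma wedge1_neq0 X : ~ (X =0= (fun=> 0)) ->
  ~ forall s, wedge (fun _ : 'I_1 => X) s =0= (fun=> 0).
Proof.
move=> /germ_component_neq0[i Xi] Xw; apply: Xi.
by apply: filterS (Xw (fun=> i)) => z; rewrite /wedge det_mx11 mxE.
Qed.

Definition pair_family X Y (i : 'I_2) := if i == 0 then X else Y.

Lemma wedge_pair_neq0 X Y : ~ (det2 X Y =0= (fun=> 0)) ->
  ~ forall s, wedge (pair_family X Y) s =0= (fun=> 0).
Proof.
move=> XY Xw; apply: XY; apply: filterS (Xw id) => z.
by rewrite /wedge det_mx2 !mxE.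
Qed.

Lemma centralizer_self X : holo_germ X -> centralizer X X.
Proof. by move=> dX; split=> //; near=> z; rewrite /lie_bracket subrr.
Unshelve. all: by end_near. Qed.

Lemma centralizer_scale X Y (c : K) : holo_germ X ->
  Y =0= (fun z => c *: X z) -> centralizer X Y.
Proof.
move=> dX YX.
(* Derivatives at [z] depend on values around [z], so the equality is needed on a neighbourhood of
   each nearby point. *)
have YXn : \forall z \near (0 : 'rV[K]_2), \forall y \near z, Y y = c *: X y.
  exact: nbhs_interior YX.
split.
  near=> z; apply: (near_eq_differentiable (f := fun z => c *: X z)).
    have h : \forall y \near z, Y y = c *: X y by near: z.
    by apply: filterS h => y ->.
  by apply: differentiableZ; near: z.
near=> z.
have h : \forall y \near z, Y y = c *: X y by near: z.
have dXz : differentiable X z by near: z.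
rewrite /lie_bracket (near_eq_derive _ h) (nbhs_singleton h).
rewrite (@deriveZ _ _ _ X c) //; last exact: diff_derivable.
by rewrite !deriveE // linearZ /= subrr.
Unshelve. all: by end_near. Qed.

Lemma free1 X : ~ (X =0= (fun=> 0)) -> free_germs (fun _ : 'I_1 => X).
Proof.
move=> X0 c c0 i; rewrite (ord1 i); apply: contrapT => /eqP ci; apply: X0.
apply: filterS c0 => z; rewrite big_ord1 => /eqP.
by rewrite scaler_eq0 (negPf ci) => /eqP.
Qed.

Lemma free2 X Y : ~ (X =0= (fun=> 0)) ->
  (forall c : K, ~ (Y =0= (fun z => c *: X z))) -> free_germs (pair_family X Y).
Proof.
move=> X0 nc c c0.
have cXY : \forall z \near (0 : 'rV[K]_2), c 0 *: X z + c 1 *: Y z = 0.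
  apply: filterS c0 => z; rewrite big_ord_recl big_ord1 /pair_family /=.
  by have -> : lift ord0 ord0 = 1 :> 'I_2 by exact: val_inj.
have c1 : c 1 = 0.
  apply: contrapT => /eqP c1; apply: (nc (- (c 1)^-1 * c 0)).
  apply: filterS cXY => z /eqP; rewrite addrC addr_eq0 => /eqP e.
  by rewrite -[LHS](scalerK c1) e scalerN scalerA mulNr scaleNr.
have c00 : c 0 = 0.
  apply: contrapT => /eqP ci; apply: X0; apply: filterS cXY => z.
  by rewrite c1 scale0r addr0 => /eqP; rewrite scaler_eq0 (negPf ci) => /eqP.
by move=> i; case: (ord2_cases i) => ->.
Qed.

(** For distinct indices [i] and [j], the relation [c j *: Y i - c i *: Y j = 0] and freeness force
    [c i = 0]; then [Y i] is the zero germ, against freeness. *)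
Lemma free_multiples_le1 n X (Y : 'I_n -> 'rV[K]_2 -> 'rV[K]_2) :
  (forall i, exists c : K, Y i =0= (fun z => c *: X z)) -> free_germs Y ->
  (n <= 1)%N.
Proof.
move=> /choice[c cP] Yfree; rewrite leqNgt; apply/negP => n1.
pose i : 'I_n := Ordinal (ltnW n1); pose j : 'I_n := Ordinal n1.
have ij : i != j by [].
pose e k := if k == i then c j else if k == j then - c i else 0.
have sumE (z : 'rV[K]_2) (d : 'I_n -> K) :
    (forall k, k != i -> k != j -> d k = 0) ->
    \sum_k d k *: Y k z = d i *: Y i z + d j *: Y j z.
  move=> d0; rewrite (bigD1 i) //= (bigD1 j) 1?eq_sym //= big1 ?addr0 // => k.
  by move=> /andP[ki kj]; rewrite d0 // scale0r.
have ci : c i = 0.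
  have := Yfree e _ j; rewrite /e eqxx eq_sym (negPf ij) => h.
  apply/eqP; rewrite -oppr_eq0; apply/eqP; apply: h.
  have ci := cP i; have cj := cP j.
  near=> z; rewrite sumE => [|k /negPf -> /negPf -> //].
  have -> : Y i z = c i *: X z by near: z.
  have -> : Y j z = c j *: X z by near: z.
  rewrite eqxx eq_sym (negPf ij) eqxx !scalerA -scalerDl mulNr mulrC subrr.
  exact: scale0r.
have /(_ _ i) := Yfree (fun k => (k == i)%:R); rewrite eqxx => h.
have /eqP := oner_neq0 K; apply; apply: h.
have ci' := cP i; near=> z; rewrite sumE => [|k /negPf -> //].
have -> : Y i z = c i *: X z by near: z.
by rewrite ci scale0r scaler0 eq_sym (negPf ij) scale0r addr0.
Unshelve. all: by end_near. Qed.

End Rank.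

(** * Evaluation of the rank and the dimension, and the trichotomy *)

Lemma ereal_sup_nat (R : realType) (P : nat -> Prop) (N : nat) : P N ->
  (forall n, P n -> (n <= N)%N) ->
  ereal_sup [set (n%:R : R)%:E | n in [set n | P n]]%classic = N%:R%:E.
Proof.
move=> PN maxN; apply/eqP; rewrite eq_le; apply/andP; split.
  by apply: ge_ereal_sup => _ [n Pn <-]; rewrite lee_fin ler_nat; exact: maxN.
by apply: ereal_sup_ubound; exists N.
Qed.

Lemma centralizer_rank_eq (R : realType) (X : 'rV[R[i]]_2 -> 'rV[R[i]]_2) N
    (Y : 'I_N -> 'rV[R[i]]_2 -> 'rV[R[i]]_2) :
  (forall i, centralizer X (Y i)) -> ~ (forall s, wedge Y s =0= (fun=> 0)) ->
  (forall n (Z : 'I_n -> 'rV[R[i]]_2 -> 'rV[R[i]]_2),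
     (forall i, centralizer X (Z i)) -> (N < n)%N ->
     forall s, wedge Z s =0= (fun=> 0)) ->
  centralizer_rank X = N%:R%:E.
Proof.
move=> XY Yw Zw; apply: ereal_sup_nat => [|n [Z [XZ nZ]]]; first by exists Y.
by rewrite leqNgt; apply/negP => Nn; apply: nZ; exact: Zw.
Qed.

Lemma centralizer_dim_eq (R : realType) (X : 'rV[R[i]]_2 -> 'rV[R[i]]_2) N
    (Y : 'I_N -> 'rV[R[i]]_2 -> 'rV[R[i]]_2) :
  (forall i, centralizer X (Y i)) -> free_germs Y ->
  (forall n (Z : 'I_n -> 'rV[R[i]]_2 -> 'rV[R[i]]_2),
     (forall i, centralizer X (Z i)) -> free_germs Z -> (n <= N)%N) ->
  centralizer_dim X = N%:R%:E.
Proof.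
move=> XY Yfree Zfree; apply: ereal_sup_nat => [|n [Z [XZ fZ]]]; first by exists Y.
exact: Zfree fZ.
Qed.

Lemma centralizer_dim_ge (R : realType) (X : 'rV[R[i]]_2 -> 'rV[R[i]]_2) N
    (Y : 'I_N -> 'rV[R[i]]_2 -> 'rV[R[i]]_2) :
  (forall i, centralizer X (Y i)) -> free_germs Y ->
  (N%:R%:E <= centralizer_dim X)%E.
Proof.
by move=> XY Yfree; apply: ereal_sup_ubound; exists N => //; exists Y.
Qed.

Theorem proposition8 (R : realType) (X : 'rV[R[i]]_2 -> 'rV[R[i]]_2)
    (X_holo : holo_germ X) (X_neq0 : ~ (X =0= (fun=> 0))) :
  [\/ [/\ centralizer_rank X = 1%:E, centralizer_dim X = 1%:E
        & forall Y : 'rV[R[i]]_2 -> 'rV[R[i]]_2,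
            centralizer X Y <->
            exists c : R[i], Y =0= (fun z => c *: X z)],
      [/\ (2%:E <= centralizer_dim X)%E, centralizer_rank X = 1%:E
        & exists f : mero_germ R[i], first_integral X f /\ ~ mero_const f]
    | centralizer_rank X = 2%:E /\ liouvillian_integrable X].
Proof.
have uc := @complex_unique_continuation R.
have XX := centralizer_self X_holo.
have pairC Y : centralizer X Y -> forall i, centralizer X (pair_family X Y i).
  by move=> XY i; rewrite /pair_family; case: ifP.
(* A commuting field generically independent of [X] leads to case (c); otherwise the whole
   centralizer is collinear with [X]. *)
have [[Y [XY nXY]]|noY] :=
    pselect (exists Y, centralizer X Y /\ ~ (det2 X Y =0= (fun=> 0))).
  apply: Or33; split; last exact: liouvillian_of_commuting XY nXY.
  apply: (centralizer_rank_eq (pairC Y XY) (wedge_pair_neq0 nXY)).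
  by move=> n Z _ n2 s; exact: wedge_gt2.
have XY0 Y : centralizer X Y -> det2 X Y =0= (fun=> 0).
  by move=> XY; apply: contrapT => nXY; apply: noY; exists Y.
have rank1 : centralizer_rank X = 1%:E.
  apply: (centralizer_rank_eq (fun=> XX) (wedge1_neq0 X_neq0)) => n Z XZ n1 s.
  (* Only [n = 2] remains; both fields are collinear with [X], hence with each other. *)
  have [n2|n2] := ltnP 2 n; first exact: wedge_gt2.
  have n2E : n = 2%N by apply/eqP; rewrite eqn_leq n2.
  move: Z XZ s; rewrite n2E => Z XZ s; apply: wedge2.
  exact: (germ_det2_trans uc X_holo (XZ _).1 (XZ _).1 X_neq0
    (XY0 _ (XZ _)) (XY0 _ (XZ _))).
(* A collinear field that is not a constant multiple of [X] gives case (b); if there is none, case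
   (a) holds. *)
have [[Y [XY nc]]|allY] := pselect (exists Y, centralizer X Y /\
    forall c : R[i], ~ (Y =0= (fun z => c *: X z))).
  apply: Or32; split; [|exact: rank1|].
    exact: (centralizer_dim_ge (pairC Y XY) (free2 X_neq0 nc)).
  exact: (first_integral_of_commuting uc X_holo XY X_neq0 (XY0 Y XY) nc).
have multiple Y : centralizer X Y -> exists c : R[i], Y =0= (fun z => c *: X z).
  move=> XY; apply: contrapT => noc; apply: allY; exists Y; split=> // c Yc.
  by apply: noc; exists c.
apply: Or31; split; [exact: rank1 | | move=> Y].
  apply: (centralizer_dim_eq (fun=> XX) (free1 X_neq0)) => n Z XZ Zfree.
  exact: (free_multiples_le1 (fun i => multiple _ (XZ i)) Zfree).
split; first exact: multiple.
by move=> [c]; exact: centralizer_scale.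
Qed.
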